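(* Let $y\in F(\mathcal D(F))$ and let $x^\dagger\in\mathcal D(F)$ be a solution of $F(x)=y$ with $\mathcal R(x^\dagger)<\infty$ and $\partial\mathcal R(x^\dagger)\ne\emptyset$. Assume that there is a constant $C_S>0$ such that $$\mathcal S(y_1,y_3)\le C_S\bigl(\mathcal S(y_1,y_2)+\mathcal S(y_3,y_2)\bigr)\quad\text{for all }y_1,y_2,y_3\in Y,$$ and that $x^\dagger$ satisfies the variational source condition: for some $\xi^\dagger\in\partial\mathcal R(x^\dagger)$ and some index function $\phi$ there exists $\beta\in[0,1)$ such that for all $\tilde x\in\mathcal D(F)$ with $\mathcal R(\tilde x)\le\mathcal R(x^\dagger)$, $$-\langle\xi^\dagger,\tilde x-x^\dagger\rangle\le\beta D_{\xi^\dagger}(\tilde x,x^\dagger)+\phi\bigl(\mathcal S(F(\tilde x),F(x^\dagger))\bigr).$$ Let $(y^\delta)_{\delta>0}\subseteq Y$ be a family of noisy data with $\mathcal S(y,y^\delta)\le\delta$, and let $(\hat x^\delta)_{\delta>0}\subseteq\mathcal D(F)$ be a family such that $$\forall\delta>0:\ \mathcal R(\hat x^\delta)\le\mathcal R(x^\dagger)\qquad\text{and}\qquad\exists\tau>0\ \forall\delta>0:\ \mathcal S(F(\hat x^\delta),y^\delta)\le\tau\delta .$$ Then, for all $\delta>0$, $$D_{\xi^\dagger}(\hat x^\delta,x^\dagger)\le\frac{1}{1-\beta}\,\phi\bigl(C_S(\tau+1)\,\delta\bigr).$$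
   Context: Setting: $X$ is a real topological vector space with dual $X^*$ and duality pairing $\langle\cdot,\cdot\rangle$, $Y$ is a set (topological space), $F:\mathcal D(F)\subseteq X\to Y$, and $\mathcal R:X\to[0,\infty]$, $\mathcal S:Y\times Y\to[0,\infty]$ are functionals. The subdifferential is $\partial\mathcal R(x)=\{\xi\in X^*:\mathcal R(\tilde x)\ge\mathcal R(x)+\langle\xi,\tilde x-x\rangle\ \forall\tilde x\in X\}$ and, for $\xi\in\partial\mathcal R(x)$, the Bregman distance is $D_\xi(\tilde x,x)=\mathcal R(\tilde x)-\mathcal R(x)-\langle\xi,\tilde x-x\rangle$. An index function is a monotonically increasing function $\phi:\mathbb R^+\to\mathbb R^+$ with $\lim_{t\to0}\phi(t)=0$; it is extended by $\phi(0)=0$ and $\phi(\infty)=\infty$. *)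

(* Defs.v *)
From HB Require Import structures.
From mathcomp Require Import all_boot all_order all_algebra.
From mathcomp Require Import all_classical all_reals all_analysis.
Set Implicit Arguments.
Unset Strict Implicit.
Unset Printing Implicit Defensive.
Import Order.TTheory GRing.Theory Num.Theory.
Import numFieldNormedType.Exports.
Local Open Scope classical_set_scope.
Local Open Scope ring_scope.

(* [R^o] is [R] seen as a module (and topological space) over itself; the
   coercion lets [xi x] denote the duality pairing. *)
Record dual (R : realType) (X : topologicalLmodType R) := Dual {
  dual_linear :> {linear X -> R^o};
  dual_continuous : continuous (dual_linear : X -> R^o)
}.

Definition subdifferential (R : realType) (X : topologicalLmodType R)
    (Reg : X -> \bar R) (x : X) : set (dual X) :=
  [set xi : dual X | forall xt : X, (Reg x + (xi (xt - x))%:E <= Reg xt)%E].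

(* Meaningful when [Reg x] is finite: [+oo - +oo] is [-oo] in [\bar R]. *)
Definition bregman (R : realType) (X : topologicalLmodType R)
    (Reg : X -> \bar R) (xi : dual X) (xt x : X) : \bar R :=
  (Reg xt - Reg x - (xi (xt - x))%:E)%E.

(* A function from ]0, +oo[ to itself, encoded as a total function on [R] whose
   values outside of ]0, +oo[ are irrelevant. Monotonicity is not strict. *)
Definition index_function (R : realType) (phi : R -> R) : Prop :=
  [/\ forall t, 0 < t -> 0 < phi t,
      forall s t, 0 < s -> s <= t -> phi s <= phi t
    & phi t @[t --> 0^'+] --> 0].

(* Extension of an index function to [0, +oo] by 0 at 0 and +oo at +oo; the
   values at negative arguments, never used, are set to 0. *)
Definition index_ext (R : realType) (phi : R -> R) (t : \bar R) : \bar R :=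
  match t with
  | r%:E => if 0 < r then (phi r)%:E else 0%E
  | +oo%E => +oo%E
  | -oo%E => 0%E
  end.

(* [F : D -> Y] is encoded as a total function whose values outside of [D] are
   irrelevant. *)
Definition variational_source_condition (R : realType)
    (X : topologicalLmodType R) (Y : Type) (D : set X) (F : X -> Y)
    (Reg : X -> \bar R) (S : Y -> Y -> \bar R)
    (xd : X) (xi : dual X) (phi : R -> R) (beta : R) : Prop :=
  forall xt : X, D xt -> (Reg xt <= Reg xd)%E ->
    ((- xi (xt - xd))%:E
       <= beta%:E * bregman Reg xi xt xd + index_ext phi (S (F xt) (F xd)))%E.

(* Main.v *)
Require Import Defs.
From HB Require Import structures.
From mathcomp Require Import all_boot all_order all_algebra.
From mathcomp Require Import all_classical all_reals all_analysis.
From mathcomp Require Import lra.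
Set Implicit Arguments.
Unset Strict Implicit.
Unset Printing Implicit Defensive.
Import Order.TTheory GRing.Theory Num.Theory.
Import numFieldNormedType.Exports.
Local Open Scope classical_set_scope.
Local Open Scope ring_scope.

(** On the sublevel set of [Reg xd] the Bregman distance is dominated by the
    linear term [- <xi, xt - xd>], because the remaining part
    [Reg xt - Reg xd] of the distance is nonpositive there. The source condition
    bounds this linear term by [beta * D + phi (S (F xt) (F xd))], so a fraction
    [beta < 1] of the Bregman distance [D] can be absorbed on the left:
    [D <= (1 - beta)^-1 * phi (S (F xt) (F xd))]
    ([bregman_le_of_source_condition]). This is a stability estimate involving
    exact data only. Noise enters through the quasi-triangle inequality, which
    gives [S (F (xh delta)) y <= CS * (tau * delta + delta)], and the monotonicity
    of [phi] ([index_ext_homo]) turns this into the stated rate. *)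

(** The extension stays monotone across [0] because an index function is positive
    on positive arguments. *)
Lemma index_ext_homo (R : realType) (phi : R -> R) :
  index_function phi -> {homo index_ext phi : s t / (s <= t)%E}.
Proof.
move=> [phi_gt0 phi_homo _] [s| |] [t| |] //=; rewrite ?leey// => st; last first.
  by case: ifPn => // t_gt0; rewrite lee_fin ltW// phi_gt0.
rewrite lee_fin in st; case: ifPn => [s_gt0|_].
  by rewrite (lt_le_trans s_gt0 st) lee_fin phi_homo.
by case: ifPn => // t_gt0; rewrite lee_fin ltW// phi_gt0.
Qed.

Lemma index_ext_ge0 (R : realType) (phi : R -> R) (t : \bar R) :
  index_function phi -> (0 <= index_ext phi t)%E.
Proof. by move=> phi_index; apply: (index_ext_homo phi_index (leNye t)). Qed.

(** Finiteness of [d] allows [beta * d] to be moved to the left: for [0 < beta],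
    [+oo <= beta * +oo + p] holds for every [0 <= p]. *)
Lemma absorb_le (R : realType) (beta : R) (d p : \bar R) :
  beta < 1 -> d \is a fin_num -> (0 <= p)%E ->
  (d <= beta%:E * d + p)%E -> (d <= ((1 - beta)^-1)%:E * p)%E.
Proof.
rewrite -subr_gt0 => beta_lt1; case: d => [d| |] // _; case: p => [p| |] // _.
  by rewrite -EFinM -EFinD !lee_fin [_^-1 * p]mulrC ler_pdivlMr// => dp; lra.
by rewrite gt0_muley ?lte_fin ?invr_gt0// leey.
Qed.

Lemma bregman_le_pairing (R : realType) (X : topologicalLmodType R)
    (Reg : X -> \bar R) (xi : dual X) (xt x : X) :
  Reg x \is a fin_num -> (Reg xt <= Reg x)%E ->
  (bregman Reg xi xt x <= (- xi (xt - x))%:E)%E.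
Proof.
move=> Reg_fin Reg_le.
by rewrite /bregman EFinN -[leRHS]add0e leeD2r// leeBlDr// add0e.
Qed.

Lemma bregman_fin_num (R : realType) (X : topologicalLmodType R)
    (Reg : X -> \bar R) (xi : dual X) (xt x : X) :
  Reg xt \is a fin_num -> Reg x \is a fin_num ->
  bregman Reg xi xt x \is a fin_num.
Proof. by move=> xt_fin x_fin; rewrite !fin_numB xt_fin x_fin. Qed.

(** Absorbing is legitimate because [Reg] is nonnegative and [Reg xd] is finite, so
    that the Bregman distance is finite on the sublevel set of [Reg xd]. *)
Lemma bregman_le_of_source_condition (R : realType) (X : topologicalLmodType R)
    (Y : Type) (D : set X) (F : X -> Y) (Reg : X -> \bar R) (S : Y -> Y -> \bar R)
    (xd xt : X) (xi : dual X) (phi : R -> R) (beta : R) :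
  (forall x, 0 <= Reg x)%E -> (Reg xd < +oo)%E ->
  index_function phi -> beta < 1 ->
  variational_source_condition D F Reg S xd xi phi beta ->
  D xt -> (Reg xt <= Reg xd)%E ->
  (bregman Reg xi xt xd
     <= ((1 - beta)^-1)%:E * index_ext phi (S (F xt) (F xd)))%E.
Proof.
move=> Reg_ge0 Reg_xd phi_index beta_lt1 vsc xtD Reg_le.
have xd_fin : Reg xd \is a fin_num by rewrite ge0_fin_numE.
have xt_fin : Reg xt \is a fin_num.
  by rewrite ge0_fin_numE// (le_lt_trans Reg_le).
apply: absorb_le => //; [exact: bregman_fin_num|exact: index_ext_ge0|].
exact: le_trans (bregman_le_pairing xi xd_fin Reg_le) (vsc _ xtD Reg_le).
Qed.

Theorem theorem2p8 (R : realType) (X : topologicalLmodType R) (Y : Type)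
    (D : set X) (F : X -> Y) (Reg : X -> \bar R) (S : Y -> Y -> \bar R)
    (Reg_ge0 : forall x, (0 <= Reg x)%E)
    (S_ge0 : forall y1 y2, (0 <= S y1 y2)%E)
    (y : Y) (Fy : (F @` D) y)
    (xd : X) (xdD : D xd) (Fxd : F xd = y)
    (Reg_xd : (Reg xd < +oo)%E) (sub_xd : subdifferential Reg xd !=set0)
    (CS : R) (CS_gt0 : 0 < CS)
    (S_triangle : forall y1 y2 y3 : Y,
      (S y1 y3 <= CS%:E * (S y1 y2 + S y3 y2))%E)
    (xi : dual X) (xi_sub : subdifferential Reg xd xi)
    (phi : R -> R) (phi_index : index_function phi)
    (beta : R) (beta_ge0 : 0 <= beta) (beta_lt1 : beta < 1)
    (vsc : variational_source_condition D F Reg S xd xi phi beta)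
    (yd : R -> Y) (yd_noise : forall delta : R, 0 < delta ->
      (S y (yd delta) <= delta%:E)%E)
    (xh : R -> X) (xhD : forall delta : R, 0 < delta -> D (xh delta))
    (Reg_xh : forall delta : R, 0 < delta -> (Reg (xh delta) <= Reg xd)%E)
    (tau : R) (tau_gt0 : 0 < tau)
    (S_xh : forall delta : R, 0 < delta ->
      (S (F (xh delta)) (yd delta) <= (tau * delta)%:E)%E) :
  forall delta : R, 0 < delta ->
    (bregman Reg xi (xh delta) xd
       <= ((1 - beta)^-1)%:E * index_ext phi (CS * (tau + 1) * delta)%:E)%E.
Proof.
move=> delta delta_gt0.
have xh_le := bregman_le_of_source_condition Reg_ge0 Reg_xd phi_index beta_lt1
  vsc (xhD _ delta_gt0) (Reg_xh _ delta_gt0).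
apply: (le_trans xh_le).
apply: lee_wpmul2l; first by rewrite lee_fin invr_ge0 subr_ge0 ltW.
apply: (index_ext_homo phi_index); rewrite Fxd.
apply: (le_trans (S_triangle _ (yd delta) _)).
rewrite -mulrA EFinM lee_pmul2l// mulrDl mul1r EFinD.
exact: leeD (S_xh _ delta_gt0) (yd_noise _ delta_gt0).
Qed.
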